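(* Let $k$ be a finite field with $\mathrm{char}(k)\neq 2$ and let $m\ge 1$. Every double coset in $\mathrm{GL}_m(k[[z]])\backslash \mathrm{GL}_m(k((z)))/\mathrm{GL}_m(k((z^2)))$ contains a block diagonal matrix each of whose diagonal blocks is one of the $1\times 1$ blocks $(1)$, $(z)$, or a $2\times 2$ block $\begin{pmatrix}1& z\\ 0 & z^i\end{pmatrix}$ with $i>1$ an integer; and this representative is unique up to reordering of the diagonal blocks.
   Context: $k[[z]]$ is the ring of formal power series, $k((z))$ its fraction field, and $k((z^2))\subset k((z))$ the subfield of Laurent series in $z^2$. *)

(* Defs.v *)
From HB Require Import structures.
From mathcomp Require Import all_boot all_order all_algebra fraction.
From mathcomp Require Import boolp.

Set Implicit Arguments.
Unset Strict Implicit.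
Unset Printing Implicit Defensive.
Import GRing.Theory.
Local Open Scope ring_scope.

(* k[[z]]: a formal power series is its sequence of coefficients. The record
   keeps it apart from nat -> k, whose ring structure is pointwise. *)
Record fps (k : fieldType) := Fps { fps_coef :> nat -> k }.

HB.instance Definition _ (k : fieldType) := gen_eqMixin (fps k).
HB.instance Definition _ (k : fieldType) := gen_choiceMixin (fps k).

Section PowerSeries.
Variable k : fieldType.
Implicit Types f g h : fps k.

Lemma fps_eqP f g : f =1 g -> f = g.
Proof. by case: f g => [f] [g] /= /funext ->. Qed.

Definition fps_zero : fps k := Fps (fun=> 0).
Definition fps_one : fps k := Fps (fun n => (n == 0%N)%:R).
Definition fps_opp f : fps k := Fps (fun n => - f n).
Definition fps_add f g : fps k := Fps (fun n => f n + g n).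
Definition fps_mul f g : fps k := Fps (fun n => \sum_(i < n.+1) f i * g (n - i)%N).

Fact fps_addA : associative fps_add.
Proof. by move=> f g h; apply: fps_eqP => n /=; rewrite addrA. Qed.
Fact fps_addC : commutative fps_add.
Proof. by move=> f g; apply: fps_eqP => n /=; rewrite addrC. Qed.
Fact fps_add0 : left_id fps_zero fps_add.
Proof. by move=> f; apply: fps_eqP => n /=; rewrite add0r. Qed.
Fact fps_addN : left_inverse fps_zero fps_opp fps_add.
Proof. by move=> f; apply: fps_eqP => n /=; rewrite addNr. Qed.

HB.instance Definition _ :=
  GRing.isZmodule.Build (fps k) fps_addA fps_addC fps_add0 fps_addN.

Definition fps_trunc N f : {poly k} := \poly_(i < N) f i.

Lemma fps_mul_poly (p q : {poly k}) f g n :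
  (forall i, (i <= n)%N -> p`_i = f i) -> (forall i, (i <= n)%N -> q`_i = g i) ->
  fps_mul f g n = (p * q)`_n.
Proof.
move=> pf qg; rewrite coefM /=; apply: eq_bigr => i _.
by rewrite pf ?qg ?leq_subr // -ltnS.
Qed.

Lemma coef_trunc N f i : (i < N)%N -> (fps_trunc N f)`_i = f i.
Proof. by move=> iN; rewrite coef_poly iN. Qed.

Lemma fps_mul_trunc N f g n : (n < N)%N ->
  fps_mul f g n = (fps_trunc N f * fps_trunc N g)`_n.
Proof.
move=> nN; apply: fps_mul_poly => i le_in; apply: coef_trunc;
  exact: leq_ltn_trans nN.
Qed.

Fact fps_mulA : associative fps_mul.
Proof.
move=> f g h; apply: fps_eqP => n.
transitivity (fps_trunc n.+1 f * (fps_trunc n.+1 g * fps_trunc n.+1 h))`_n.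
  apply: fps_mul_poly => i le_in; first by rewrite coef_trunc.
  by rewrite -(@fps_mul_trunc n.+1).
rewrite mulrA; symmetry; apply: fps_mul_poly => i le_in.
  by rewrite -(@fps_mul_trunc n.+1).
by rewrite coef_trunc.
Qed.

Fact fps_mulC : commutative fps_mul.
Proof.
by move=> f g; apply: fps_eqP => n; rewrite !(@fps_mul_trunc n.+1) // mulrC.
Qed.

Fact fps_mul1 : left_id fps_one fps_mul.
Proof.
move=> f; apply: fps_eqP => n /=; rewrite big_ord_recl /= mul1r subn0.
by rewrite big1 ?addr0 // => i _; rewrite mul0r.
Qed.

Fact fps_mulD : left_distributive fps_mul fps_add.
Proof.
move=> f g h; apply: fps_eqP => n /=; rewrite -big_split /=.
by apply: eq_bigr => i _; rewrite mulrDl.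
Qed.

Fact fps_one_neq0 : fps_one != fps_zero.
Proof.
by apply/eqP => /(congr1 (fun f : fps k => f 0%N)) /eqP /=; rewrite oner_eq0.
Qed.

HB.instance Definition _ := GRing.Zmodule_isComNzRing.Build (fps k)
  fps_mulA fps_mulC fps_mul1 fps_mulD fps_one_neq0.

(* The first n coefficients of the inverse of a series with invertible
   constant term. *)
Fixpoint fps_inv_seq f n : seq k :=
  if n is m.+1 then
    let s := fps_inv_seq f m in
    rcons s ((f 0%N)^-1 * ((m == 0%N)%:R - \sum_(i < m) s`_i * f (m - i)%N))
  else [::].

Definition fps_unit : {pred fps k} := fun f => f 0%N != 0.

Definition fps_inv f : fps k :=
  if fps_unit f then Fps (fun n => (fps_inv_seq f n.+1)`_n) else f.

Lemma size_fps_inv_seq f n : size (fps_inv_seq f n) = n.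
Proof. by elim: n => //= n IHn; rewrite size_rcons IHn. Qed.

Lemma nth_fps_inv_seq f m n : (n < m)%N ->
  (fps_inv_seq f m)`_n = (fps_inv_seq f n.+1)`_n.
Proof.
elim: m => // m IHm; rewrite ltnS leq_eqVlt => /predU1P[-> // | lt_nm].
by rewrite /= nth_rcons size_fps_inv_seq lt_nm IHm.
Qed.

Fact fps_mulVx : {in fps_unit, left_inverse (1 : fps k) fps_inv *%R}.
Proof.
move=> f; rewrite -topredE /= => Uf; apply: fps_eqP => n.
rewrite /fps_inv Uf; change (\sum_(i < n.+1) (fps_inv_seq f i.+1)`_i * f (n - i)%N
  = (n == 0%N)%:R).
rewrite big_ord_recr /= subnn nth_rcons size_fps_inv_seq ltnn eqxx.
rewrite mulrC mulrA divff // mul1r addrCA.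
rewrite [X in _ + X](_ : _ = 0) ?addr0 //; apply/eqP; rewrite subr_eq0; apply/eqP.
by apply: eq_bigr => i _; rewrite (nth_fps_inv_seq f (ltn_ord i)).
Qed.

Lemma fps_coef0M f g : (f * g) 0%N = f 0%N * g 0%N.
Proof. by rewrite [LHS]big_ord_recl big_ord0 addr0. Qed.

Fact fps_unitPl f g : g * f = 1 -> fps_unit f.
Proof.
move=> /(congr1 (fun h : fps k => h 0%N)); rewrite fps_coef0M => gf1.
apply/eqP => f0; move/eqP: gf1.
by rewrite f0 mulr0 eq_sym /= oner_eq0.
Qed.

Fact fps_inv_out : {in [predC fps_unit], fps_inv =1 id}.
Proof. by move=> f; rewrite inE -topredE /= /fps_inv => /negbTE ->. Qed.

HB.instance Definition _ := GRing.ComNzRing_hasMulInverse.Build (fps k)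
  fps_mulVx fps_unitPl fps_inv_out.

Lemma fps_neq0_ord f : f != 0 ->
  exists2 n, f n != 0 & forall i, (i < n)%N -> f i = 0.
Proof.
move=> f0; have [n fn] : exists n, f n != 0.
  apply: contrapT => f_eq0; case/eqP: f0; apply: fps_eqP => n.
  by apply: contrapT => /eqP fn; case: f_eq0; exists n.
have exf : exists n, f n != 0 by exists n.
case: (ex_minnP exf) => {fn}n fn minn; exists n => // i lt_in.
by apply/eqP; apply: contraTT lt_in => fi; rewrite -leqNgt minn.
Qed.

Fact fps_integral : GRing.integral_domain_axiom (fps k).
Proof.
move=> f g fg0; have [//|/fps_neq0_ord[a fa fa0]] := eqVneq f 0.
have [//|/fps_neq0_ord[b gb gb0]] := eqVneq g 0; exfalso.
have lt_a : (a < (a + b).+1)%N by rewrite ltnS leq_addr.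
have := congr1 (fun h : fps k => h (a + b)%N) fg0.
rewrite [LHS](bigD1 (Ordinal lt_a)) //= addKn big1 => [|i].
  by move/eqP; rewrite addr0 mulf_eq0 (negPf fa) (negPf gb).
rewrite -val_eqE /= neq_ltn => /orP[lt_ia | lt_ai].
  by rewrite fa0 // mul0r.
by rewrite gb0 ?mulr0 // ltn_subLR ?ltn_add2r // -ltnS.
Qed.

HB.instance Definition _ := GRing.ComUnitRing_isIntegral.Build (fps k) fps_integral.

Definition fps_z : fps k := Fps (fun n => (n == 1%N)%:R).

(* The substitution f(z) |-> f(z^2). *)
Definition fps_subst_sq f : fps k :=
  Fps (fun n => if odd n then 0 else f n./2).

Definition laurent := {fraction fps k}.
HB.instance Definition _ := GRing.Field.on laurent.

Definition laurent_of : fps k -> laurent := @FracField.tofrac (fps k).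
HB.instance Definition _ := GRing.RMorphism.on laurent_of.

Definition laurent_z : laurent := laurent_of fps_z.

(* k((z^2)): the series z^(-2N) f(z^2) with f in k[[z]]. *)
Definition laurent_sq : {pred laurent} :=
  fun x => `[< exists (N : nat) (f : fps k),
                 x = laurent_of (fps_subst_sq f) / (laurent_z ^+ 2) ^+ N >].

End PowerSeries.

Arguments fps_z {k}.
Arguments laurent_z {k}.

(* GL_m of a subring S of K: invertible, with entries and entries of the
   inverse in S. *)
Definition GL_over (K : fieldType) (S : {pred K}) (m : nat) (V : 'M[K]_m) : Prop :=
  [/\ V \in unitmx, V \is a mxOver S & invmx V \is a mxOver S].

(* h is in GL_m(k[[z]]) g GL_m(k((z^2))). *)
Definition in_double_coset (k : fieldType) (m : nat) (g h : 'M[laurent k]_m) : Prop :=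
  exists (U : 'M[fps k]_m) (V : 'M[laurent k]_m),
    [/\ U \in unitmx, GL_over (@laurent_sq k) V
      & h = map_mx (@laurent_of k) U *m g *m V].

(* The blocks (1), (z) and (1 z ; 0 z^i) for i > 1. *)
Variant block := BlockOne | BlockZ | BlockUpper of {i : nat | (1 < i)%N}.

Definition block_code (b : block) : bool + {i : nat | (1 < i)%N} :=
  match b with BlockOne => inl false | BlockZ => inl true | BlockUpper i => inr i end.
Definition block_decode (c : bool + {i : nat | (1 < i)%N}) : block :=
  match c with inl false => BlockOne | inl true => BlockZ | inr i => BlockUpper i end.
Lemma block_codeK : cancel block_code block_decode. Proof. by case. Qed.
HB.instance Definition _ := Equality.copy block (can_type block_codeK).

Definition block_size (b : block) : nat :=
  if b is BlockUpper _ then 2%N else 1%N.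

Definition block_matrix (k : fieldType) (b : block) : 'M[laurent k]_(block_size b) :=
  match b with
  | BlockOne => 1%:M
  | BlockZ => laurent_z%:M
  | BlockUpper i =>
      block_mx 1%:M laurent_z%:M
               0    (laurent_z ^+ val i)%:M : 'M_(1 + 1)
  end.

Definition blocks_size (s : seq block) : nat :=
  (\sum_(j < size s) block_size (nth BlockOne s j))%N.

Definition block_diag (k : fieldType) (s : seq block) : 'M[laurent k]_(blocks_size s) :=
  \mxdiag_(j < size s) block_matrix k (nth BlockOne s j).

(* Main.v *)
Require Import Defs.
From HB Require Import structures.
From mathcomp Require Import all_boot all_order all_algebra.
From mathcomp Require Import perm fraction generic_quotient boolp zify ring.

(* Let s be the automorphism z |-> -z of K = k((z)); its fixed field is k((z^2)). The
   double coset of g is determined by the cocycle c = s(g) g^-1, which satisfies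
   s(c) c = 1, up to c ~ s(U) c U^-1 with U in GL_m(k[[z]]): if s(U) c_g U^-1 = c_h then
   V = g^-1 U^-1 h is fixed by s. In terms of the semilinear involution x |-> s(x) c of
   the rows K^m, one splits off one block at a time. If c is integral, the reduction of
   the involution mod z is a linear involution over k, and an eigenvector lifts to give
   a block (1) or (z). Otherwise let d > 0 be the order of the pole of c; a row v whose
   image w = z^d s(v) c is nonzero mod z spans with w a summand on which c is
   antidiagonal with entries z^-d, (-z)^d, which is the cocycle of (1 z; 0 z^(d+1)).
   In both cases a complement stable under the involution can be written explicitly.
   For uniqueness, all these cocycles are monomial matrices with entries +-z^e, and
   U intertwines two of them; a nonzero term in the expansion of det U(0) matches their
   exponents, and the signs of the entries with e = 0. *)

Set Implicit Arguments.
Unset Strict Implicit.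
Unset Printing Implicit Defensive.
Import Order.TTheory GRing.Theory Num.Theory.
Local Open Scope ring_scope.

(** * Completion of bases, standard cocycles and their block types *)

(** Gaussian elimination writes [P] as [col_ebase P] times the first r rows of [row_ebase P], so the
    remaining rows of [row_ebase P] complete it. *)
Lemma row_free_complete (F : fieldType) r p (P : 'M[F]_(r, r + p)) :
  row_free P -> exists C : 'M_(p, r + p), col_mx P C \in unitmx.
Proof.
move=> P_free; exists (dsubmx (row_ebase P)).
have -> : col_mx P (dsubmx (row_ebase P)) =
    block_mx (col_ebase P) 0 0 1%:M *m row_ebase P.
  rewrite -[X in _ *m X]vsubmxK mul_block_col !mul0mx addr0 mul1mx add0r; congr col_mx.
  rewrite -[LHS]mulmx_ebase (eqP P_free) -[X in _ *m X = _]vsubmxK.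
  by rewrite pid_mx_row -mulmxA mul_row_col mul1mx mul0mx addr0.
rewrite unitmx_mul row_ebase_unit unitmxE det_ublock det1 mulr1 -unitmxE.
by rewrite col_ebase_unit.
Qed.

Lemma row_free_nz (F : fieldType) n (v : 'rV[F]_n) : v != 0 -> row_free v.
Proof. by rewrite /row_free rank_rV => ->. Qed.

(** The cocycle s(g) g^-1 of each block g, in a suitable lattice basis. The block with corner z^i
    has a cocycle with exponents -(i-1) and i-1. *)
Definition block_std (K : fieldType) (z : K) (b : block) : 'M[K]_(block_size b) :=
  match b with
  | BlockOne => 1%:M
  | BlockZ => (-1)%:M
  | BlockUpper i =>
      block_mx 0 (z ^- (val i).-1)%:M ((- z) ^+ (val i).-1)%:M 0 : 'M_(1 + 1)
  end.

(** The size is an index of the predicate, so that inductions on the blocks need no casts between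
    sums of block sizes. *)
Inductive split_form (K : fieldType) (z : K) : seq block -> forall n, 'M[K]_n -> Prop :=
| SplitNil (c : 'M_0) : split_form z [::] c
| SplitCons b s n (c : 'M_n) :
    split_form z s c -> split_form z (b :: s) (block_mx (block_std z b) 0 0 c).

Lemma split_form_exists (K : fieldType) (z : K) s : exists n (c : 'M_n), split_form z s c.
Proof.
elim: s => [|b s [n [c sc]]]; first by exists 0%N, 0; constructor.
by exists (block_size b + n)%N, (block_mx (block_std z b) 0 0 c); constructor.
Qed.

(** [block_matrix] over any field with a chosen element; over k((z)) the two agree by conversion. *)
Definition block_mat (K : fieldType) (z : K) (b : block) : 'M[K]_(block_size b) :=
  match b with
  | BlockOne => 1%:M
  | BlockZ => z%:M
  | BlockUpper i => block_mx 1%:M z%:M 0 (z ^+ val i)%:M : 'M_(1 + 1)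
  end.

Definition block_diag_mat (K : fieldType) (z : K) (s : seq block) : 'M[K]_(blocks_size s) :=
  \mxdiag_(j < size s) block_mat z (nth BlockOne s j).

Lemma blocks_size_cons b s : blocks_size (b :: s) = (block_size b + blocks_size s)%N.
Proof. exact: big_ord_recl. Qed.

Lemma block_diag_mat_cons (K : fieldType) (z : K) b s e :
  castmx (e, e) (block_diag_mat z (b :: s)) =
  block_mx (block_mat z b) 0 0 (block_diag_mat z s).
Proof.
by rewrite /block_diag_mat mxdiag_recl castmx_comp castmx_id.
Qed.

Lemma unitmx_perm (F : fieldType) n (A : 'M[F]_n) :
  A \in unitmx -> exists s : 'S_n, forall a, A a (s a) != 0.
Proof.
rewrite unitmxE unitfE => detA; apply: contrapT => noperm; case/eqP: detA.
apply: big1 => s _; suff [a Aa] : exists a, A a (s a) = 0.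
  by rewrite (bigD1 a) //= Aa mul0r mulr0.
apply: contrapT => noa; apply: noperm; exists s => a.
by apply/eqP => Aa; apply: noa; exists a.
Qed.

(* The pairs (e, b) record the nonzero entries (-1)^b z^e of a monomial matrix; the
   sign is kept only for e = 0, where it is an invariant. *)
Definition monomial_type (b : block) : seq (int * bool) :=
  match b with
  | BlockOne => [:: (0, false)]
  | BlockZ => [:: (0, true)]
  | BlockUpper i => [:: (- ((val i).-1)%:Z, false); (((val i).-1)%:Z, false)]
  end.

(** Each block has a key pair that occurs once in its own list and in no list of another block, so
    counting keys counts blocks. The key of a 2x2 block is its positive exponent. *)
Lemma monomial_type_inj s s' :
  perm_eq (flatten (map monomial_type s)) (flatten (map monomial_type s')) -> perm_eq s s'.
Proof.
pose key b := if b is BlockUpper i then (((val i).-1)%:Z, false) else (0, b == BlockZ).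
have count_block b b' : count_mem (key b) (monomial_type b') = (b' == b).
  have eqU i j : (BlockUpper i == BlockUpper j) = (val i == val j).
    by apply/eqP/eqP => [[->] | /val_inj ->].
  case: b b' => [||i] [||j] //=; rewrite ?eqU ?addn0 /key ?xpair_eqE ?andbT //.
  - by case: j => [[|[|j]]].
  - by case: j => [[|[|j]]].
  - by case: i => [[|[|i]]].
  - by case: i => [[|[|i]]].
  case: i j => [i i_gt1] [j j_gt1] /=; lia.
have count_key b t : count_mem (key b) (flatten (map monomial_type t)) = count_mem b t.
  by elim: t => //= b' t IHt; rewrite count_cat IHt count_block.
move=> ss'; rewrite /perm_eq; apply/allP => b _ /=; apply/eqP.
by rewrite -!count_key (seq.permP ss').
Qed.

Lemma ord2_ind (P : 'I_2 -> Prop) : P ord0 -> P ord_max -> forall a, P a.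
Proof.
by move=> P0 P1 [[|[|a]] lt_a] //; [move: P0 | move: P1]; congr P; apply: val_inj.
Qed.

(** * Monomial matrices *)

Section Monomial.
Variables (K : fieldType) (z : K).

(** The list [l] is tied to the rows by multiplicities only, so that no bijection between rows and
    positions in [l] has to be carried along. *)
Definition monomial n (c : 'M[K]_n) (l : seq (int * bool)) :=
  exists (p : 'I_n -> 'I_n) (e : 'I_n -> int) (sg : 'I_n -> bool),
    [/\ involutive p, forall a, e (p a) = - e a, forall a, e a = 0 -> p a = a,
        forall a b, c a b = if b == p a then (-1) ^+ sg a * z ^ e a else 0
      & forall x, (\sum_a (((e a, (e a == 0) && sg a) == x) : nat))%N = count_mem x l].

Lemma monomial_block m n (c : 'M_m) (c' : 'M_n) l l' :
  monomial c l -> monomial c' l' -> monomial (block_mx c 0 0 c') (l ++ l').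
Proof.
move=> [p [e [sg [pK ep pe def_c ct]]]] [p' [e' [sg' [pK' ep' pe' def_c' ct']]]].
exists (fun a => unsplit (match split a with inl i => inl (p i) | inr j => inr (p' j) end)).
exists (fun a => match split a with inl i => e i | inr j => e' j end).
exists (fun a => match split a with inl i => sg i | inr j => sg' j end).
split=> [a|a|a|a b|x].
- by case: (split_ordP a) => i ->; rewrite ?(unsplitK (inl _)) ?(unsplitK (inr _)) /= ?pK ?pK'.
- by case: (split_ordP a) => i _; rewrite ?(unsplitK (inl _)) ?(unsplitK (inr _)) /= ?ep ?ep'.
- by case: (split_ordP a) => i ->; rewrite ?(unsplitK (inl _)) ?(unsplitK (inr _));
    [move=> /pe -> | move=> /pe' ->].
- case: (split_ordP a) => i ->; case: (split_ordP b) => j -> /=;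
    rewrite ?block_mxEul ?block_mxEur ?block_mxEdl ?block_mxEdr ?mxE ?def_c ?def_c';
    by rewrite ?eq_lshift ?eq_rshift ?eq_lrshift ?eq_rlshift.
- rewrite count_cat -ct -ct' big_split_ord /=; congr (_ + _)%N; apply: eq_bigr => i _.
    by rewrite (unsplitK (inl i)).
  by rewrite (unsplitK (inr i)).
Qed.

Lemma block_std_monomial b : monomial (block_std z b) (monomial_type b).
Proof.
case: b => [||i].
- exists id, (fun=> 0), (fun=> false); split=> // [a b|x].
    by rewrite [a]ord1 [b]ord1 mxE /= expr0z mulr1.
  by rewrite big_ord1 /= addn0.
- exists id, (fun=> 0), (fun=> true); split=> // [a b|x].
    by rewrite [a]ord1 [b]ord1 mxE /= expr0z mulr1.
  by rewrite big_ord1 /= addn0.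
have d_gt0 : ((val i).-1 != 0)%N by case: i => [[|[|d]]].
pose d : int := ((val i).-1)%:Z.
have dn0 : d == 0 = false by rewrite /d; apply/negbTE.
pose p (a : 'I_2) : 'I_2 := rev_ord a.
exists p, (fun a => if a == ord0 then - d else d).
(* The second row holds (-z)^(i-1), whence a sign given by the parity of i-1. *)
exists (fun a => (a != ord0) && odd (val i).-1).
have l0 : ord0 = lshift 1 (0 : 'I_1) by apply: val_inj.
have r1 : ord_max = rshift 1 (0 : 'I_1) by apply: val_inj.
have p0 : p ord0 = ord_max by apply: val_inj.
have p1 : p ord_max = ord0 by apply: val_inj.
split=> [a|||a b|x].
- exact: rev_ordK.
- by apply: ord2_ind; rewrite ?p0 ?p1 //= opprK.
- by apply: ord2_ind => /= /eqP; rewrite ?oppr_eq0 dn0.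
- move: a b; apply: ord2_ind; apply: ord2_ind; rewrite ?p0 ?p1 /=.
  + by rewrite l0 (@block_mxEul _ 1 1 1 1) mxE.
  + by rewrite l0 r1 (@block_mxEur _ 1 1 1 1) mxE eqxx mulr1n mul1r exprnN.
  + rewrite l0 r1 (@block_mxEdl _ 1 1 1 1) mxE eqxx mulr1n signr_odd.
    by rewrite -[z ^ d]/(z ^+ (val i).-1) -exprMn mulN1r.
  by rewrite r1 (@block_mxEdr _ 1 1 1 1) mxE.
by rewrite !big_ord_recl big_ord0 /= oppr_eq0 dn0.
Qed.

Lemma split_form_monomial s n (c : 'M[K]_n) :
  split_form z s c -> monomial c (flatten (map monomial_type s)).
Proof.
elim=> {s n c} [c | b s n c _ IHc].
  by exists id, (fun=> 0), (fun=> false); split=> // [[]|x] //; rewrite big_ord0.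
exact: monomial_block (block_std_monomial b) IHc.
Qed.

End Monomial.

(** * Cocycles over a discrete valuation ring with involution *)

Lemma rmorph_unitmx (R S : comUnitRingType) (f : {rmorphism R -> S}) n (A : 'M[R]_n) :
  A \in unitmx -> map_mx f A \in unitmx.
Proof. by rewrite !unitmxE det_map_mx; apply: rmorph_unit. Qed.

(* A discrete valuation ring O with fraction field K and residue field k, together with
   an involution that negates the uniformizer pi and is trivial on k. Working with these
   properties alone keeps the power series out of the matrix computations. *)
Record twisted_dvr (O : comUnitRingType) (K k : fieldType)
    (iota : {rmorphism O -> K}) (res : {rmorphism O -> k})
    (sO : {rmorphism O -> O}) (sK : {rmorphism K -> K}) (pi : O) : Prop := TwistedDvr {
  iota_inj : injective iota;
  sKK : involutive sK;
  sK_iota : forall f, sK (iota f) = iota (sO f);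
  res_sO : forall f, res (sO f) = res f;
  sO_pi : sO pi = - pi;
  res_surj : forall a, exists f, res f = a;
  res_unit : forall f, (f \is a GRing.unit) = (res f != 0);
  res_eq0P : forall f, res f = 0 <-> exists g, f = pi * g;
  iota_pi_neq0 : iota pi != 0;
  iota_frac : forall x, exists n f, x = iota f / iota pi ^+ n;
  two_neq0 : 2 != 0 :> k
}.

Section TwistedDvr.
Variables (O : comUnitRingType) (K k : fieldType).
Variables (iota : {rmorphism O -> K}) (res : {rmorphism O -> k}).
Variables (sO : {rmorphism O -> O}) (sK : {rmorphism K -> K}) (pi : O).
Hypothesis dvr : twisted_dvr iota res sO sK pi.

Local Notation lift := (map_mx iota).
Local Notation twist := (map_mx sK).
Local Notation z := (iota pi).

Lemma twist_K m n : involutive (twist : 'M[K]_(m, n) -> _).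
Proof. by move=> A; apply/matrixP => i j; rewrite !mxE (sKK dvr). Qed.

Lemma twist_lift m n (A : 'M[O]_(m, n)) : twist (lift A) = lift (map_mx sO A).
Proof. by apply/matrixP => i j; rewrite !mxE (sK_iota dvr). Qed.

Lemma res_twist m n (A : 'M[O]_(m, n)) : map_mx res (map_mx sO A) = map_mx res A.
Proof. by apply/matrixP => i j; rewrite !mxE (res_sO dvr). Qed.

Lemma lift_mx_inj m n : injective (lift : 'M[O]_(m, n) -> _).
Proof.
move=> A B /matrixP AB; apply/matrixP => i j; apply: (iota_inj dvr).
by have := AB i j; rewrite !mxE.
Qed.

Lemma unitmx_res n (U : 'M[O]_n) : (U \in unitmx) = (map_mx res U \in unitmx).
Proof. by rewrite !unitmxE det_map_mx unitfE (res_unit dvr). Qed.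

(** This is c' = s(U) c U^-1, the effect of a change of lattice basis, written without the
    inverse. *)
Definition cohomologous n (c c' : 'M[K]_n) :=
  exists2 U : 'M[O]_n, U \in unitmx & twist (lift U) *m c = c' *m lift U.

Lemma cohomologous_refl n (c : 'M[K]_n) : cohomologous c c.
Proof. by exists 1%:M; rewrite ?unitmx1 // !map_mx1 mulmx1 mul1mx. Qed.

Lemma cohomologous_sym n (c c' : 'M[K]_n) :
  cohomologous c c' -> cohomologous c' c.
Proof.
case=> U UU Uc; exists (invmx U); first by rewrite unitmx_inv.
have VU : lift (invmx U) *m lift U = 1%:M by rewrite -map_mxM mulVmx // map_mx1.
have UV : lift U *m lift (invmx U) = 1%:M by rewrite -map_mxM mulmxV // map_mx1.
rewrite -[LHS]mulmx1 -UV -mulmxA [c' *m _]mulmxA -Uc !mulmxA -map_mxM VU map_mx1.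
by rewrite mul1mx.
Qed.

Lemma cohomologous_trans n (c c' c'' : 'M[K]_n) :
  cohomologous c c' -> cohomologous c' c'' -> cohomologous c c''.
Proof.
case=> U UU Uc [V UV Vc]; exists (V *m U); first by rewrite unitmx_mul UV.
by rewrite !map_mxM -mulmxA Uc mulmxA Vc mulmxA.
Qed.

Lemma cohomologous_block m n (a a' : 'M[K]_m) (b b' : 'M[K]_n) :
  cohomologous a a' -> cohomologous b b' ->
  cohomologous (block_mx a 0 0 b) (block_mx a' 0 0 b').
Proof.
case=> U UU Ua [V UV Vb]; exists (block_mx U 0 0 V).
  by rewrite unitmxE det_ublock unitrM -!unitmxE UU.
by rewrite !map_block_mx !mulmx_block !map_mx0 !(mul0mx, mulmx0, addr0, add0r) Ua Vb.
Qed.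

Definition cocycle n (c : 'M[K]_n) := twist c *m c = 1%:M.

Lemma cohomologous_cocycle n (c c' : 'M[K]_n) :
  cohomologous c c' -> cocycle c -> cocycle c'.
Proof.
rewrite /cocycle => -[U UU Uc] cc.
have UL : lift U \in unitmx by apply: rmorph_unitmx.
apply: (can_inj (mulmxK UL)); rewrite mul1mx -mulmxA -Uc mulmxA -map_mxM -Uc.
by rewrite map_mxM twist_K -mulmxA cc mulmx1.
Qed.

Lemma cocycle_dr m n (a : 'M[K]_m) (b : 'M[K]_n) :
  cocycle (block_mx a 0 0 b) -> cocycle b.
Proof.
rewrite /cocycle map_block_mx mulmx_block !map_mx0 !(mul0mx, mulmx0, addr0, add0r).
by rewrite scalar_mx_block => /eq_block_mx[].
Qed.

(* If the rows of g are a basis of a lattice L, this is the matrix, in that basis, of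
   the semilinear involution of K^n whose fixed points are k((z^2))^n. *)
Definition coboundary n (g : 'M[K]_n) := twist g *m invmx g.

Lemma coboundaryP n (g : 'M[K]_n) c :
  g \in unitmx -> twist g = c *m g -> coboundary g = c.
Proof. by move=> Ug gc; rewrite /coboundary gc mulmxK. Qed.

Lemma coboundaryE n (g : 'M[K]_n) :
  g \in unitmx -> twist g = coboundary g *m g.
Proof. by move=> Ug; rewrite /coboundary mulmxKV. Qed.

Lemma coboundary_cocycle n (g : 'M[K]_n) :
  g \in unitmx -> cocycle (coboundary g).
Proof.
move=> Ug; apply: (can_inj (mulmxK Ug)).
by rewrite mul1mx -mulmxA -coboundaryE // -map_mxM -coboundaryE // twist_K.
Qed.

Lemma cohomologous_coboundary n (U : 'M[O]_n) (g : 'M[K]_n) c :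
    U \in unitmx -> g \in unitmx ->
    twist (lift U *m g) = c *m (lift U *m g) ->
  cohomologous (coboundary g) c.
Proof.
move=> UU Ug Ugc; exists U => //.
by rewrite /coboundary mulmxA -map_mxM Ugc -!mulmxA mulmxV // mulmx1.
Qed.

Lemma coboundary_block m n (g : 'M[K]_m) (h : 'M[K]_n) :
    g \in unitmx -> h \in unitmx ->
  coboundary (block_mx g 0 0 h) = block_mx (coboundary g) 0 0 (coboundary h).
Proof.
move=> Ug Uh; apply: coboundaryP; first by rewrite unitmxE det_ublock unitrM -!unitmxE Ug.
rewrite map_block_mx mulmx_block !map_mx0 !(mul0mx, mulmx0, addr0, add0r).
by rewrite -!coboundaryE.
Qed.

(** A factor V fixed by s cancels in s(h) h^-1. Conversely, the relation between the cocycles says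
    that s acts on Ug and on h through the same left factor, so (Ug)^-1 h is fixed. *)
Lemma double_cosetP n (g h : 'M[K]_n) : g \in unitmx -> h \in unitmx ->
  (exists (U : 'M[O]_n) (V : 'M[K]_n), [/\ U \in unitmx, V \in unitmx, twist V = V
     & h = lift U *m g *m V])
  <-> cohomologous (coboundary g) (coboundary h).
Proof.
move=> Ug Uh; split=> [[U [V [UU UV twV def_h]]] | [U UU Uc]].
  exists U => //.
  have twh : twist h = twist (lift U) *m coboundary g *m g *m V.
    by rewrite def_h !map_mxM twV -(mulmxA _ (coboundary g)) -(coboundaryE Ug).
  apply: (can_inj (mulmxK Ug)); apply: (can_inj (mulmxK UV)).
  by rewrite -twh (coboundaryE Uh) [X in _ *m X = _]def_h !mulmxA.
have ULU : lift U \in unitmx by apply: rmorph_unitmx.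
have UUg : lift U *m g \in unitmx by rewrite unitmx_mul ULU.
pose V := invmx (lift U *m g) *m h.
have UgV : lift U *m g *m V = h by rewrite mulKVmx.
have UV : V \in unitmx by rewrite unitmx_mul unitmx_inv UUg.
have twUg : twist (lift U *m g) = coboundary h *m (lift U *m g).
  by rewrite map_mxM (coboundaryE Ug) mulmxA Uc mulmxA.
have twV : twist V = V.
  have UtwUg : twist (lift U *m g) \in unitmx by apply: rmorph_unitmx.
  apply: (can_inj (mulKmx UtwUg)); rewrite -map_mxM UgV twUg -mulmxA UgV.
  exact: coboundaryE.
by exists U, V.
Qed.

(** * Splitting off one block *)

(** Complete over the residue field and lift the new rows entrywise; the result is invertible
    because it is so mod pi. *)
Lemma unimodular_complete r p (P : 'M[O]_(r, r + p)) :
  row_free (map_mx res P) -> exists2 U : 'M[O]_(r + p), U \in unitmx & usubmx U = P.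
Proof.
case/row_free_complete => C UC.
pose L a := sval (cid (res_surj dvr a)).
have LK a : res (L a) = a by rewrite /L; case: cid.
exists (col_mx P (map_mx L C)); last by rewrite col_mxKu.
rewrite unitmx_res map_col_mx; congr (_ \in unitmx): UC; congr col_mx.
by apply/matrixP => i j; rewrite !mxE LK.
Qed.

(** Adding [T] times the first basis vectors to the others changes the complement; the equation on
    [T] makes the new complement stable under the involution. *)
Lemma cohomologous_clear r p (a : 'M[K]_r) X (b : 'M[K]_p) (T : 'M[O]_(p, r)) :
    b *m lift T - twist (lift T) *m a = X ->
  cohomologous (block_mx a 0 X b) (block_mx a 0 0 b).
Proof.
move=> def_X; exists (block_mx 1%:M 0 T 1%:M).
  by rewrite unitmxE det_lblock !det1 mulr1 unitr1.
rewrite !map_block_mx !mulmx_block !map_mx1 !map_mx0 -def_X.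
by rewrite !(mul0mx, mulmx0, addr0, add0r, mul1mx, mulmx1) addrC subrK.
Qed.

(** The rows of [P] span a summand of the lattice on which the involution acts by [a]; extending
    them to a basis makes the cocycle block triangular. *)
Lemma cohomologous_row r n (c : 'M[K]_n) (a : 'M[K]_r) (P : 'M[O]_(r, n)) :
    row_free (map_mx res P) -> twist (lift P) *m c = a *m lift P ->
  exists p (e : (r + p = n)%N) (X : 'M_(p, r)) (b : 'M_p),
    cohomologous c (castmx (e, e) (block_mx a 0 X b)).
Proof.
move=> P_free; have le_rn : (r <= n)%N by rewrite -(eqP P_free) rank_leq_col.
have [p e] : exists p, (r + p = n)%N by exists (n - r)%N; rewrite subnKC.
subst n; move: P_free => /unimodular_complete[U UU <-] Pc.
have UL : lift U \in unitmx by apply: rmorph_unitmx.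
exists p, erefl; pose d := twist (lift U) *m c *m invmx (lift U).
have dU : d *m lift U = twist (lift U) *m c by rewrite mulmxKV.
exists (dlsubmx d), (drsubmx d); exists U => //; rewrite -dU castmx_id; congr (_ *m _).
have ud : usubmx d = row_mx a 0.
  have -> : usubmx d = twist (lift (usubmx U)) *m c *m invmx (lift U).
    by rewrite !map_usubmx !mul_usub_mx.
  rewrite Pc -mulmxA map_usubmx mul_usub_mx mulmxV // scalar_mx_block block_mxEv.
  by rewrite col_mxKu mul_mx_row mulmx1 mulmx0.
by rewrite -{1}[d]submxK /ulsubmx /ursubmx ud row_mxKl row_mxKr.
Qed.

(** A bound on the order of the pole survives a change of basis, since U and U^-1 are integral. *)
Lemma cohomologous_integral n (c c' : 'M[K]_n) d :
  cohomologous c c' -> (exists C, z ^+ d *: c = lift C) -> exists C, z ^+ d *: c' = lift C.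
Proof.
case=> U UU Uc [C cC]; exists (map_mx sO U *m C *m invmx U).
have UL : lift U \in unitmx by apply: rmorph_unitmx.
apply: (can_inj (mulmxK UL)); rewrite -scalemxAl -Uc twist_lift scalemxAr cC.
by rewrite -!map_mxM mulmxKV.
Qed.

Lemma half_exists : exists h, 2 * h = 1 /\ sO h = h.
Proof.
have U2 : (2 : O) \is a GRing.unit by rewrite (res_unit dvr) rmorph_nat (two_neq0 dvr).
exists 2^-1; split; first by rewrite divrr.
by rewrite rmorphV // rmorph_nat.
Qed.

Lemma split_integral n (c : 'M[K]_n) (i : 'I_n) : cocycle c -> (exists C, c = lift C) ->
  exists b p (e : (block_size b + p = n)%N) c',
    cohomologous c (castmx (e, e) (block_mx (block_std z b) 0 0 c')).
Proof.
move=> cc [C def_c].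
pose x : 'rV[O]_n := delta_mx 0 i.
pose P (b : bool) := x + (-1) ^+ b *: (x *m C).
(* The two candidates x + s(x)c and x - s(x)c are eigenvectors over [O]. Their sum 2x is nonzero mod
   pi, so one of them is too. *)
have [b Pb] : exists b, map_mx res (P b) != 0.
  apply: contrapT => P_eq0.
  have {}P_eq0 b : map_mx res (P b) = 0.
    by apply/eqP/negP => /negP Pb; apply: P_eq0; exists b.
  have /rowP/(_ i) : map_mx res (P false + P true) = 0 by rewrite map_mxD !P_eq0 addr0.
  rewrite /P expr0 expr1 scale1r scaleN1r addrACA subrr addr0 !mxE !eqxx !rmorphD rmorph1 /=.
  by move/eqP; rewrite -mulr2n (negPf (two_neq0 dvr)).
have twx : twist (lift x) = lift x by rewrite !map_delta_mx.
have Pc : twist (lift (P b)) *m c = ((-1) ^+ b)%:M *m lift (P b).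
  rewrite /P !(map_mxD, map_mxZ, map_mxM) twx -def_c (rmorph_sign iota) (rmorph_sign sK).
  rewrite mulmxDl -scalemxAl -(mulmxA _ _ c) cc mulmx1 mul_scalar_mx scalerDr scalerA.
  by rewrite -expr2 sqrr_sign scale1r addrC.
have [p [e [X [Y cXY]]]] := cohomologous_row (row_free_nz Pb) Pc.
subst n; rewrite castmx_id in cXY.
have [C' XC'] : exists C', block_mx ((-1) ^+ b)%:M 0 X Y = lift C'.
  have [|] := @cohomologous_integral _ _ _ 0 cXY; last first.
    by rewrite expr0 scale1r => C' eqC'; exists C'.
  by exists C; rewrite expr0 scale1r.
have def_X : X = lift (dlsubmx C').
  by rewrite map_dlsubmx -XC' block_mxKdl.
(* This is the lower left block of the cocycle identity. *)
have cXY' : twist Y *m X = - ((-1) ^+ b *: twist X).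
  have := cohomologous_cocycle cXY cc.
  rewrite /cocycle map_block_mx mulmx_block scalar_mx_block => /eq_block_mx[_ _ /eqP + _].
  by rewrite mul_mx_scalar addrC addr_eq0 => /eqP.
have YX : Y *m twist X = - ((-1) ^+ b *: X).
  apply: (inv_inj (@twist_K _ _)).
  by rewrite map_mxM twist_K cXY' map_mxN map_mxZ rmorph_sign.
have [h [h2 sh]] := half_exists.
have cl : cohomologous c (block_mx ((-1) ^+ b)%:M 0 0 Y).
  apply: cohomologous_trans cXY _.
  (* Averaging over the involution: each of the two terms of the clearing equation contributes
     X/2. *)
  apply: (@cohomologous_clear _ _ _ _ _ (- ((-1) ^+ b * h) *: map_mx sO (dlsubmx C'))).
  rewrite !map_mxZ !rmorphN !rmorphM (rmorph_sign iota) (rmorph_sign sK) /=.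
  rewrite (sK_iota dvr) sh -twist_lift -def_X.
  rewrite twist_K mul_mx_scalar -scalemxAr YX scalerN !scalerA -scaleNr -scalerBl.
  rewrite -[RHS]scale1r; congr (_ *: _).
  transitivity (((-1) ^+ b) ^+ 2 * (2 * iota h)); first by ring.
  by rewrite sqrr_sign mul1r -(rmorph_nat iota) -rmorphM h2 rmorph1.
by case: (b) cl => cl; [exists BlockZ | exists BlockOne]; exists p, erefl, Y; rewrite castmx_id.
Qed.

(* The summand is spanned by a basis vector v and its image w = v C under z^(d+1) times
   the semilinear involution. They are independent mod z because C^2 = 0 mod z. *)
Lemma split_polar n (c : 'M[K]_n) d (C : 'M[O]_n) : cocycle c ->
    z ^+ d.+1 *: c = lift C -> map_mx res C != 0 ->
  exists b p (e : (block_size b + p = n)%N) c',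
    cohomologous c (castmx (e, e) (block_mx (block_std z b) 0 0 c')).
Proof.
move=> cc def_C resC; set C0 := map_mx res C in resC.
have zX_neq0 m : z ^+ m != 0 by rewrite expf_neq0 ?(iota_pi_neq0 dvr).
have sKz : sK z = - z by rewrite (sK_iota dvr) (sO_pi dvr) rmorphN.
(* The cocycle identity makes s(C)C a multiple of pi, and s is trivial on residues. *)
have C00 : C0 *m C0 = 0.
  have -> : C0 *m C0 = map_mx res (map_mx sO C *m C) by rewrite map_mxM res_twist.
  have -> : map_mx sO C *m C = ((- pi) ^+ d.+1 * pi ^+ d.+1)%:M.
    apply: lift_mx_inj.
    rewrite map_mxM -twist_lift -def_C map_mxZ -scalemxAl -scalemxAr.
    rewrite cc scalerA map_scalar_mx scalemx1; congr scalar_mx.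
    by rewrite rmorphM !rmorphXn rmorphN sKz.
  have res_pi : res pi = 0 by apply/(res_eq0P dvr); exists 1; rewrite mulr1.
  by rewrite map_scalar_mx rmorphM !rmorphXn /= res_pi (exprS 0) mul0r mulr0 raddf0.
have [i Ci] : exists i, row i C0 != 0.
  apply: contrapT => rowC; case/eqP: resC; apply/row_matrixP => i; rewrite row0.
  by apply/eqP/negP => /negP Ci; apply: rowC; exists i.
pose v : 'rV[O]_n := delta_mx 0 i.
have twv : twist (lift v) = lift v by rewrite !map_delta_mx.
have lw : lift (v *m C) = z ^+ d.+1 *: (lift v *m c).
  by rewrite map_mxM -def_C scalemxAr.
have Pv : map_mx res v *m C0 != 0 by rewrite map_delta_mx -rowE.
have P_free : row_free (map_mx res (col_mx v (v *m C))).
  have kv u : u *: (map_mx res v *m C0) = 0 -> u = 0.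
    by move/eqP; rewrite scaler_eq0 (negPf Pv) orbF => /eqP.
  apply: inj_row_free => u; rewrite -[u]hsubmxK map_col_mx mul_row_col map_mxM.
  rewrite [lsubmx u]mx11_scalar [rsubmx u]mx11_scalar !mul_scalar_mx => uP.
  have ul : lsubmx u 0 0 = 0.
    apply: kv; move/(congr1 (mulmx^~ C0)): uP.
    by rewrite /= mulmxDl -!scalemxAl -mulmxA C00 mulmx0 scaler0 addr0 mul0mx.
  have ur : rsubmx u 0 0 = 0 by apply: kv; rewrite -[RHS]uP ul scale0r add0r.
  by rewrite ul ur !raddf0 row_mx0.
(* The pole has order d+1 = i-1, hence i = d+2. *)
pose i1 : {m : nat | (1 < m)%N} := Sub d.+2 isT.
have Pc : twist (lift (col_mx v (v *m C))) *m c =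
    (block_mx 0 (z ^- d.+1)%:M ((- z) ^+ d.+1)%:M 0 : 'M_(1 + 1)) *m lift (col_mx v (v *m C)).
  rewrite !map_col_mx twv lw map_mxZ map_mxM twv mul_col_mx mul_block_col !mul0mx.
  rewrite add0r addr0 !mul_scalar_mx scalerA mulVf // scale1r.
  by rewrite -scalemxAl -mulmxA cc mulmx1 rmorphXn sKz.
have [p [e [X [Y cXY]]]] := cohomologous_row P_free Pc.
subst n; rewrite castmx_id in cXY.
have [C' XC'] := cohomologous_integral cXY (ex_intro _ C def_C).
pose x0 : 'cV_p := lsubmx (X : 'M_(p, 1 + 1)); pose x1 : 'cV_p := rsubmx (X : 'M_(p, 1 + 1)).
have def_X : X = row_mx x0 x1 by rewrite hsubmxK.
have def_x1 : z ^+ d.+1 *: x1 = lift (rsubmx (dlsubmx C' : 'M_(p, 1 + 1))).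
  rewrite map_rsubmx map_dlsubmx -XC' scale_block_mx block_mxKdl.
  by apply/matrixP => a b; rewrite !mxE.
(* The second column of the lower left block of the cocycle identity determines x0 from x1. *)
have def_x0 : x0 = - (Y *m twist (z ^+ d.+1 *: x1)).
  have := cohomologous_cocycle cXY cc.
  rewrite /cocycle map_block_mx mulmx_block scalar_mx_block => /eq_block_mx[_ _ + _].
  rewrite def_X map_row_mx mul_mx_row mul_row_block !mulmx0 add0r addr0 add_row_mx.
  rewrite -[X in _ = X]row_mx0 => /eq_row_mx[_ /eqP].
  rewrite mul_mx_scalar addr_eq0 => /eqP/(congr1 twist).
  rewrite [LHS]map_mxZ map_mxN map_mxM !twist_K fmorphV rmorphXn sKz => x01.
  rewrite map_mxZ rmorphXn sKz -scalemxAr -scalerN -x01 scalerA divff ?scale1r //.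
  by rewrite expf_neq0 ?oppr_eq0 ?(iota_pi_neq0 dvr).
exists (BlockUpper i1), p, erefl, Y; rewrite castmx_id; apply: cohomologous_trans cXY _.
(* This [T] is integral by the bound on the pole. Through the entry z^-(d+1) it clears x1, and the
   relation just found then clears x0 as well. *)
apply: (@cohomologous_clear _ _ _ _ _
  (row_mx (- map_mx sO (rsubmx (dlsubmx C' : 'M_(p, 1 + 1)))) 0)).
rewrite map_row_mx map_mx0 map_mxN -twist_lift -def_x1 map_row_mx map_mx0 map_mxN.
rewrite twist_K mul_mx_row mul_row_block !mulmx0 !mul0mx !addr0 mulmxN -def_x0.
rewrite mulNmx mul_mx_scalar scalerA mulVf // scale1r opp_row_mx add_row_mx.
by rewrite oppr0 addr0 opprK add0r -def_X.
Qed.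

(** Take the least d with z^d c integral. If d > 0, the residue of z^d c is nonzero, since otherwise
    a factor pi could be removed. *)
Lemma split_block n (c : 'M[K]_n) (i : 'I_n) : cocycle c ->
  exists b p (e : (block_size b + p = n)%N) c',
    cohomologous c (castmx (e, e) (block_mx (block_std z b) 0 0 c')).
Proof.
move=> cc.
have [N [C0 def_C0]] : exists N (C : 'M[O]_n), z ^+ N *: c = lift C.
  have cP (a : 'I_n * 'I_n) : {nf : nat * O | c a.1 a.2 = iota nf.2 / z ^+ nf.1}.
    by apply: cid; have [m [f ->]] := iota_frac dvr (c a.1 a.2); exists (m, f).
  pose m a := (sval (cP a)).1; pose f a := (sval (cP a)).2.
  exists (\max_a m a), (\matrix_(a, b) (pi ^+ (\max_a m a - m (a, b)) * f (a, b))).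
  apply/matrixP => a b; rewrite !mxE rmorphM rmorphXn /=.
  rewrite [c a b](svalP (cP (a, b))) -/(m _) -/(f _).
  have le_m : (m (a, b) <= \max_a m a)%N by rewrite (leq_bigmax (a, b)).
  rewrite -{1}(subnKC le_m) exprD mulrACA [X in X * _](mulrC) mulrACA.
  by rewrite divff ?mulr1 ?mul1r ?expf_neq0 ?(iota_pi_neq0 dvr) // mulrC.
pose integral d := `[< exists C : 'M[O]_n, z ^+ d *: c = lift C >].
have ex_int : exists d, integral d by exists N; apply/asboolP; exists C0.
case: (ex_minnP ex_int) => -[|d] /asboolP[C def_C] d_min.
  by apply: split_integral => //; exists C; rewrite -def_C expr0 scale1r.
apply: (split_polar cc def_C); apply/eqP => /matrixP resC0.
have divC a b : {g | C a b = pi * g}.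
  by apply: cid; apply/(res_eq0P dvr); have := resC0 a b; rewrite !mxE.
suff /d_min : integral d by rewrite ltnn.
apply/asboolP; exists (\matrix_(a, b) sval (divC a b)); apply/matrixP => a b.
apply: (mulfI (iota_pi_neq0 dvr)); have /matrixP/(_ a b) := def_C.
by rewrite !mxE; case: (divC a b) => g /= ->; rewrite rmorphM exprS -mulrA.
Qed.

Lemma cocycle_split_form n (c : 'M[K]_n) : cocycle c ->
  exists s c', split_form z s c' /\ cohomologous c c'.
Proof.
elim/ltn_ind: n c => -[|n] IHn c cc.
  by exists [::], c; split; [constructor | apply: cohomologous_refl].
have [b [p [e [c' cc']]]] := split_block ord0 cc.
have lt_p : (p < n.+1)%N.
  by rewrite -e; case: (b) => *; rewrite /= ?addSn ltnS ?leq_addl ?leqW ?leq_addl.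
move: IHn c cc cc' lt_p; case: _ / e => IHn c cc; rewrite castmx_id => cc' lt_p.
have [s [c'' [sc'' c'c'']]] := IHn p lt_p c' (cocycle_dr (cohomologous_cocycle cc' cc)).
exists (b :: s), (block_mx (block_std z b) 0 0 c''); split; first by constructor.
apply: cohomologous_trans cc' _; apply: cohomologous_block => //.
exact: cohomologous_refl.
Qed.

(** * Cocycles of the representatives and uniqueness of standard forms *)

Lemma block_mat_unit b : block_mat z b \in unitmx.
Proof.
have z0 := iota_pi_neq0 dvr.
case: b => [||i]; rewrite unitmxE /=; first by rewrite det1 unitr1.
  by rewrite det_scalar unitfE.
by rewrite (@det_ublock _ 1 1) det1 mul1r det_scalar unitfE !expf_neq0.
Qed.

Lemma coboundary_block_mat b : cohomologous (coboundary (block_mat z b)) (block_std z b).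
Proof.
have sKz : sK z = - z by rewrite (sK_iota dvr) (sO_pi dvr) rmorphN.
have z0 := iota_pi_neq0 dvr.
case: b => [||[i i_gt1]].
- apply: (@cohomologous_coboundary _ 1%:M); rewrite ?block_mat_unit ?unitmx1 //=.
  by rewrite map_mx1 !mul1mx map_mx1.
- apply: (@cohomologous_coboundary _ 1%:M); rewrite ?block_mat_unit ?unitmx1 //=.
  by rewrite map_mx1 !mul1mx map_scalar_mx sKz mul_scalar_mx scale_scalar_mx mulN1r.
case: i i_gt1 => [|[|d]] // d_gt0.
(* Here i = d+2. The second row of U writes z^(d+1) (1, -z) in terms of the rows of the block; the
   determinant -2 is a unit. *)
pose U : 'M[O]_(1 + 1) := block_mx 1%:M 0 (pi ^+ d.+1)%:M (- 2)%:M.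
have UU : U \in unitmx.
  rewrite unitmx_res map_block_mx map_mx0 !map_scalar_mx unitmxE det_lblock !det_scalar.
  by rewrite unitfE !rmorph1 rmorphN rmorph_nat expr1n mul1r expf_neq0 // oppr_eq0 (two_neq0 dvr).
(* The rows of A are v = (1, z) and z^(d+1) times the image of v under z |-> -z. *)
pose A : 'M[K]_(1 + 1) := block_mx 1%:M z%:M (z ^+ d.+1)%:M (- z ^+ d.+2)%:M.
have UA : lift U *m (block_mx 1%:M z%:M 0 (z ^+ d.+2)%:M : 'M_(1 + 1)) = A.
  rewrite map_block_mx mulmx_block map_mx0 map_mx1 !map_scalar_mx !mul1mx !mulmx0 !mul0mx.
  rewrite !addr0 mulmx1 -!scalar_mxM -raddfD /= rmorphXn rmorphN rmorph_nat.
  congr (block_mx _ _ _ _%:M); rewrite [z ^+ d.+2]exprSr; ring.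
apply: (cohomologous_coboundary UU (block_mat_unit (BlockUpper (exist _ d.+2 d_gt0)))).
suff : twist A = (block_mx 0 (z ^- d.+1)%:M ((- z) ^+ d.+1)%:M 0 : 'M_(1 + 1)) *m A by rewrite -UA.
rewrite /A map_block_mx mulmx_block !map_scalar_mx !mul0mx !add0r !addr0 -!scalar_mxM.
congr block_mx; congr scalar_mx;
  rewrite ?rmorph1 ?rmorphN ?rmorphXn ?sKz ?mulVf ?mulr1 ?expf_neq0 //.
  by rewrite mulrN [z ^+ d.+2]exprSr mulrA mulVf ?expf_neq0 // mul1r.
by rewrite [(- z) ^+ d.+2]exprSr mulrN opprK.
Qed.

Lemma split_form_coboundary s n (c : 'M[K]_n) : split_form z s c ->
  exists e : blocks_size s = n,
    castmx (e, e) (block_diag_mat z s) \in unitmx /\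
    cohomologous (coboundary (castmx (e, e) (block_diag_mat z s))) c.
Proof.
elim=> {s n c} [c | b s n c _ [e [+ IHc]]].
  have e : blocks_size [::] = 0%N by rewrite /blocks_size big_ord0.
  exists e; split; first by rewrite unitmxE det_mx00 unitr1.
  by rewrite [coboundary _]flatmx0 [c]flatmx0; apply: cohomologous_refl.
case: _ / e c IHc => c; rewrite castmx_id => IHc Us.
exists (blocks_size_cons b s); rewrite block_diag_mat_cons; split.
  by rewrite unitmxE det_ublock unitrM -!unitmxE block_mat_unit.
rewrite coboundary_block ?block_mat_unit //.
exact: cohomologous_block (coboundary_block_mat b) IHc.
Qed.

(* Expanding the determinant of U(0) gives a permutation s with e' a <= e (s a);
   since p and p' make both exponent families sum to 0, these are equalities. *)
Lemma monomial_unique n (c c' : 'M[K]_n) l l' :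
  monomial z c l -> monomial z c' l' -> cohomologous c c' -> perm_eq l l'.
Proof.
move=> [p [e [sg [pK ep pe def_c ct]]]] [p' [e' [sg' [pK' ep' pe' def_c' ct']]]] [U UU Uc].
have z0 := iota_pi_neq0 dvr.
(* In column p j, each side of the intertwining relation has a single term left. *)
have entry a j : iota (sO (U a j)) * ((-1) ^+ sg j * z ^ e j) =
    (-1) ^+ sg' a * z ^ e' a * iota (U (p' a) (p j)).
  have /matrixP/(_ a (p j)) := Uc; rewrite !mxE (bigD1 j) //= big1 => [|i ij].
    rewrite (bigD1 (p' a)) //= big1 => [|i ij].
      by rewrite !mxE def_c def_c' !eqxx !addr0 (sK_iota dvr).
    by rewrite def_c' (negPf ij) mul0r.
  by rewrite def_c (inj_eq (inv_inj pK)) eq_sym (negPf ij) mulr0.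
have sumv0 (q : 'I_n -> 'I_n) (f : 'I_n -> int) : involutive q -> (forall a, f (q a) = - f a) ->
    \sum_a f a = 0.
  move=> qK fq; have : \sum_a f a = - \sum_a f a.
    rewrite {1}(reindex_inj (inv_inj qK)) -sumrN; exact: eq_bigr.
  lia.
have [s Us] := unitmx_perm (etrans (esym (unitmx_res U)) UU).
(* Otherwise the entry of U at (a, s a) would be divisible by pi up to the involution, against the
   choice of s. *)
have le_e a : e' a <= e (s a).
  rewrite leNgt; apply: contra (Us a) => lt_e; rewrite mxE -(res_sO dvr).
  have [m def_m] : exists m : nat, e' a = e (s a) + m.+1 by exists `|e' a - e (s a)|%N.-1; lia.
  apply/eqP/(res_eq0P dvr);
  exists ((-1) ^+ sg (s a) * (-1) ^+ sg' a * pi ^+ m * U (p' a) (p (s a))).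
  apply: (iota_inj dvr); have := entry a (s a); rewrite def_m expfzDr //.
  rewrite -[z ^ m.+1]/(z ^+ m.+1) !rmorphM !(rmorph_sign iota) rmorphXn /=.
  set u := (-1) ^+ sg _; have u2 : u * u = 1 by rewrite -expr2 sqrr_sign.
  have ze0 : z ^ e (s a) != 0 by rewrite expfz_neq0.
  move=> E; apply: (mulIf ze0); rewrite -[LHS]mulr1 -[X in _ * X = _]u2.
  transitivity (iota (sO (U a (s a))) * (u * z ^ e (s a)) * u); first by ring.
  by rewrite E exprS; ring.
have eq_e a : e' a = e (s a).
  have : \sum_a (e (s a) - e' a) = 0.
    rewrite big_split /= sumrN (sumv0 p' e') // oppr0 addr0.
    by rewrite -[RHS](sumv0 p e) // [RHS](reindex_inj (@perm_inj _ s)).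
  move/eqP; rewrite psumr_eq0 => [/allP/(_ a)|b _]; last by rewrite subr_ge0.
  by rewrite mem_index_enum subr_eq0 => /(_ isT)/eqP.
(* At exponent 0 both monomial positions are diagonal, so an entry of U is compared with its own
   twist. Their residues are equal and nonzero, and 1 differs from -1. *)
have eq_sg a : e' a = 0 -> sg' a = sg (s a).
  move=> e'a0; have esa0 : e (s a) = 0 by rewrite -eq_e.
  have := entry a (s a); rewrite esa0 e'a0 pe // pe' // expr0z !mulr1.
  rewrite -!(rmorph_sign iota) -!rmorphM => /(iota_inj dvr)/(congr1 res).
  rewrite !rmorphM !(rmorph_sign res) (res_sO dvr) mulrC.
  have := Us a; rewrite mxE => Ua /(mulIf Ua).
  have nN1 : 1 != -1 :> k by rewrite -addr_eq0 -mulr2n (two_neq0 dvr).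
  by case: (sg' a); case: (sg (s a)) => // /eqP; rewrite ?(negPf nN1) // eq_sym (negPf nN1).
rewrite /perm_eq; apply/allP => x _ /=; apply/eqP; rewrite -ct -ct'.
rewrite (reindex_inj (@perm_inj _ s)) /=; apply: eq_bigr => a _; rewrite -eq_e.
by case: (e' a =P 0) => [/eq_sg -> |].
Qed.

Theorem split_form_unique n (c c' : 'M[K]_n) s s' :
  split_form z s c -> split_form z s' c' -> cohomologous c c' -> perm_eq s s'.
Proof.
move=> sc sc' cc'; apply: monomial_type_inj.
exact: monomial_unique (split_form_monomial sc) (split_form_monomial sc') cc'.
Qed.

End TwistedDvr.

(** * The automorphism z -> -z of k[[z]] and k((z)) *)

Section Twist.
Variable k : fieldType.
Implicit Types (f g : fps k) (x y : laurent k).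

Definition fps_coef0 f : k := f 0%N.

Fact fps_coef0_is_zmod_morphism : zmod_morphism fps_coef0.
Proof. by []. Qed.
Fact fps_coef0_is_monoid_morphism : monoid_morphism fps_coef0.
Proof. by split=> // f g; apply: fps_coef0M. Qed.
HB.instance Definition _ :=
  GRing.isZmodMorphism.Build (fps k) k fps_coef0 fps_coef0_is_zmod_morphism.
HB.instance Definition _ :=
  GRing.isMonoidMorphism.Build (fps k) k fps_coef0 fps_coef0_is_monoid_morphism.

Lemma fps_unitE f : (f \is a GRing.unit) = (fps_coef0 f != 0).
Proof. by []. Qed.

Definition fps_const (a : k) : fps k := Fps (fun n => if n == 0%N then a else 0).

Definition fps_twist f : fps k := Fps (fun n => (-1) ^+ n * f n).

Fact fps_twist_is_zmod_morphism : zmod_morphism fps_twist.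
Proof. by move=> f g; apply: fps_eqP => n /=; rewrite mulrBr. Qed.
Fact fps_twist_is_monoid_morphism : monoid_morphism fps_twist.
Proof.
split=> [|f g]; apply: fps_eqP => n /=; first by case: n => [|n]; rewrite ?mulr0 ?mulr1.
rewrite [RHS]/=; rewrite [X in _ * X = _]/= mulr_sumr; apply: eq_bigr => i _.
rewrite mulrACA -exprD subnKC // -ltnS //; exact: ltn_ord.
Qed.
HB.instance Definition _ :=
  GRing.isZmodMorphism.Build (fps k) (fps k) fps_twist fps_twist_is_zmod_morphism.
HB.instance Definition _ :=
  GRing.isMonoidMorphism.Build (fps k) (fps k) fps_twist fps_twist_is_monoid_morphism.

Lemma fps_twistK : involutive fps_twist.
Proof. by move=> f; apply: fps_eqP => n /=; rewrite mulrA -expr2 sqrr_sign mul1r. Qed.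

Lemma fps_coef0_twist f : fps_coef0 (fps_twist f) = fps_coef0 f.
Proof. by rewrite /fps_coef0 /= expr0 mul1r. Qed.

Lemma fps_mul_zE f n : (fps_z * f) n = if n is m.+1 then f m else 0.
Proof.
case: n => [|n]; first by rewrite fps_coef0M mul0r.
transitivity (\sum_(i < n.+2) (i == 1%N :> nat)%:R * f (n.+1 - i)%N) => //.
rewrite big_ord_recl mul0r add0r big_ord_recl mul1r subSS subn0 big1 ?addr0 //.
by move=> i _; rewrite mul0r.
Qed.

Lemma fps_coef0_eq0P f : reflect (exists g, f = fps_z * g) (fps_coef0 f == 0).
Proof.
apply: (iffP eqP) => [f0 | [g ->]]; last by rewrite rmorphM /= mul0r.
by exists (Fps (fun n => f n.+1)); apply: fps_eqP => -[|n]; rewrite fps_mul_zE.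
Qed.

Lemma fps_twist_z : fps_twist fps_z = - fps_z.
Proof.
by apply: fps_eqP => -[|[|n]] /=; rewrite ?mulr0 ?mulr1 ?expr1 ?oppr0.
Qed.

Lemma laurent_of_eq0 f : (laurent_of f == 0) = (f == 0).
Proof. exact: tofrac_eq0. Qed.

Lemma laurent_of_inj : injective (@laurent_of k).
Proof. by move=> f g /eqP; rewrite tofrac_eq => /eqP. Qed.

Lemma laurent_z_neq0 : laurent_z != 0 :> laurent k.
Proof.
rewrite laurent_of_eq0; apply/eqP => /(congr1 (fun f : fps k => f 1%N)) /eqP.
by rewrite /= oner_eq0.
Qed.

Lemma fracP (R : idomainType) (x : {fraction R}) :
  exists a b : R, b != 0 /\ x * FracField.tofrac b = FracField.tofrac a.
Proof.
elim/quotW: x => r; exists (frac r).1, (frac r).2; split; first exact: denom_ratioP.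
unlock FracField.tofrac; rewrite -[LHS]FracField.pi_mul; apply/eqmodP => /=.
rewrite FracField.equivfE /FracField.mulf !numden_Ratio ?mulr1 ?oner_neq0 ?denom_ratioP //.
by rewrite mulrC.
Qed.

Lemma fps_neq0_unit f : f != 0 ->
  exists n u, u \is a GRing.unit /\ f = fps_z ^+ n * u.
Proof.
move=> /fps_neq0_ord[n]; elim: n f => [|n IHn] f fn f_lt.
  by exists 0%N, f; rewrite expr0 mul1r fps_unitE.
have [g eq_f] : exists g, f = fps_z * g.
  by apply/fps_coef0_eq0P; rewrite /fps_coef0 f_lt.
have [||p [u [Uu eq_g]]] := IHn g; first by rewrite eq_f fps_mul_zE in fn.
  by move=> i lt_in; rewrite -(f_lt i.+1) // eq_f fps_mul_zE.
by exists p.+1, u; rewrite exprS -mulrA -eq_g.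
Qed.

Lemma laurentP x : exists n f, x = laurent_of f / laurent_z ^+ n.
Proof.
have [a [b [b0 xb]]] := fracP x.
have [n [u [Uu eq_b]]] := fps_neq0_unit b0.
exists n, (a * u^-1); apply: canRL (mulfK _) _; first by rewrite expf_neq0 ?laurent_z_neq0.
rewrite rmorphM /= -[laurent_of a]xb /= eq_b.
rewrite [FracField.tofrac _](rmorphM (@laurent_of k)) rmorphXn /= -mulrA -mulrA -rmorphM /=.
by rewrite divrr // rmorph1 mulr1.
Qed.

Definition laurent_expand x : {nf : nat * fps k | x = laurent_of nf.2 / laurent_z ^+ nf.1}.
Proof. by apply: cid; have [n [f ->]] := laurentP x; exists (n, f). Qed.

(* The automorphism z |-> -z of k((z)), whose fixed field is k((z^2)). *)
Definition laurent_twist x : laurent k :=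
  let nf := sval (laurent_expand x) in
  laurent_of (fps_twist nf.2) / (- laurent_z) ^+ nf.1.

(** Independence of the chosen expansion: clear denominators and apply the automorphism of
    k[[z]]. *)
Lemma laurent_twistE f n :
  laurent_twist (laurent_of f / laurent_z ^+ n) =
  laurent_of (fps_twist f) / (- laurent_z) ^+ n.
Proof.
rewrite /laurent_twist; case: (laurent_expand _) => -[p g] /= eq_fg.
have zX_neq0 q : laurent_z ^+ q != 0 :> laurent k by rewrite expf_neq0 ?laurent_z_neq0.
have NzX_neq0 q : (- laurent_z) ^+ q != 0 :> laurent k.
  by rewrite expf_neq0 ?oppr_eq0 ?laurent_z_neq0.
apply/eqP; rewrite eqr_div //; apply/eqP.
move/eqP: eq_fg; rewrite eqr_div // => /eqP.
rewrite -!rmorphXn -!rmorphM /= => /laurent_of_inj/(congr1 fps_twist).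
rewrite !rmorphM !rmorphXn /= fps_twist_z => eq_fg.
by rewrite -!rmorphN -!rmorphXn -!rmorphM /= -eq_fg.
Qed.

Lemma laurent_twist_of f : laurent_twist (laurent_of f) = laurent_of (fps_twist f).
Proof. by have := laurent_twistE f 0; rewrite !expr0 !divr1. Qed.

Fact laurent_twist_is_zmod_morphism : zmod_morphism laurent_twist.
Proof.
move=> x y; have [n [f ->]] := laurentP x; have [p [g ->]] := laurentP y.
have z0 := laurent_z_neq0; have Nz0 : - laurent_z != 0 :> laurent k by rewrite oppr_eq0.
have -> : laurent_of f / laurent_z ^+ n - laurent_of g / laurent_z ^+ p =
    laurent_of (f * fps_z ^+ p - g * fps_z ^+ n) / laurent_z ^+ (n + p).
  by rewrite -mulNr addf_div ?expf_neq0 // -exprD rmorphB !rmorphM !rmorphXn mulNr.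
rewrite !laurent_twistE -[- (laurent_of (fps_twist g) / _)]mulNr.
rewrite addf_div ?expf_neq0 // -exprD mulNr.
by rewrite !(rmorphB, rmorphM, rmorphXn) /= fps_twist_z !rmorphN.
Qed.
Fact laurent_twist_is_monoid_morphism : monoid_morphism laurent_twist.
Proof.
split; first by rewrite -[X in laurent_twist X](rmorph1 (@laurent_of k)) laurent_twist_of !rmorph1.
move=> x y; have [n [f ->]] := laurentP x; have [p [g ->]] := laurentP y.
by rewrite mulf_div -exprD -rmorphM !laurent_twistE mulf_div -exprD !rmorphM.
Qed.
HB.instance Definition _ := GRing.isZmodMorphism.Build (laurent k) (laurent k)
  laurent_twist laurent_twist_is_zmod_morphism.
HB.instance Definition _ := GRing.isMonoidMorphism.Build (laurent k) (laurent k)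
  laurent_twist laurent_twist_is_monoid_morphism.

Lemma laurent_twist_z : laurent_twist laurent_z = - laurent_z.
Proof. by rewrite laurent_twist_of fps_twist_z rmorphN. Qed.

Lemma laurent_twistK : involutive laurent_twist.
Proof.
move=> x; have [n [f ->]] := laurentP x.
rewrite laurent_twistE fmorph_div rmorphXn rmorphN /= laurent_twist_of fps_twistK.
by rewrite laurent_twist_z opprK.
Qed.

Lemma laurent_sqE (hk : 2 != 0 :> k) x : (x \in @laurent_sq k) = (laurent_twist x == x).
Proof.
have twist_subst f : fps_twist (fps_subst_sq f) = fps_subst_sq f.
  apply: fps_eqP => n /=; case: ifP => odd_n; first by rewrite mulr0.
  by rewrite -signr_odd odd_n mul1r.
have twist_zz : laurent_twist (laurent_z ^+ 2) = laurent_z ^+ 2.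
  by rewrite rmorphXn /= laurent_twist_z sqrrN.
apply/asboolP/eqP => [[N [f ->]] | twist_x].
  by rewrite fmorph_div rmorphXn /= twist_zz laurent_twist_of twist_subst.
have [n [g eq_x]] := laurentP x.
(* Doubling the exponent of the denominator makes it a power of z^2, fixed by the automorphism; the
   numerator is then fixed too. *)
pose f := fps_z ^+ n * g; have {}eq_x : x = laurent_of f / (laurent_z ^+ 2) ^+ n.
  rewrite rmorphM rmorphXn -exprM mulnC exprM expr2 invfM mulrA eq_x /=.
  by rewrite [_ * laurent_of g]mulrC mulfK ?expf_neq0 ?laurent_z_neq0.
have zn_neq0 : (laurent_z ^+ 2) ^+ n != 0 :> laurent k by rewrite !expf_neq0 ?laurent_z_neq0.
have twist_f : fps_twist f = f.
  apply: laurent_of_inj; rewrite -laurent_twist_of.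
  have -> : laurent_of f = x * (laurent_z ^+ 2) ^+ n by rewrite eq_x divfK.
  by rewrite rmorphM rmorphXn /= twist_x twist_zz.
exists n, (Fps (fun i => f i.*2)); rewrite eq_x; congr (laurent_of _ / _).
apply: fps_eqP => i /=; case: ifP => odd_i; last first.
  by rewrite halfK odd_i subn0.
(* An odd coefficient of a fixed series equals its own negative, hence vanishes as 2 is nonzero. *)
have /eqP := congr1 (fun h : fps k => h i) twist_f.
rewrite [X in X == _]/= -signr_odd odd_i mulN1r eq_sym -subr_eq0 opprK -mulr2n -mulr_natr.
by rewrite mulf_eq0 (negPf hk) orbF => /eqP.
Qed.

End Twist.

(** * Double cosets over k((z)) *)

Lemma laurent_twisted_dvr (k : fieldType) : 2 != 0 :> k ->
  twisted_dvr (@laurent_of k) (@fps_coef0 k) (@fps_twist k) (@laurent_twist k) fps_z.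
Proof.
move=> hk; split=> //.
- exact: laurent_of_inj.
- exact: laurent_twistK.
- exact: laurent_twist_of.
- exact: fps_coef0_twist.
- exact: fps_twist_z.
- by move=> a; exists (fps_const a).
- by move=> f; split=> [/eqP/fps_coef0_eq0P | /fps_coef0_eq0P/eqP].
- exact: laurent_z_neq0.
- exact: laurentP.
Qed.

(** Entries in k((z^2)) are the fixed ones, and the inverse of a fixed matrix is fixed. *)
Lemma in_double_cosetP (k : fieldType) n (g h : 'M[laurent k]_n) : 2 != 0 :> k ->
  in_double_coset g h <->
  exists (U : 'M[fps k]_n) (V : 'M[laurent k]_n),
    [/\ U \in unitmx, V \in unitmx, map_mx (@laurent_twist k) V = V
      & h = map_mx (@laurent_of k) U *m g *m V].
Proof.
move=> hk.
have sqP (V : 'M[laurent k]_n) :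
    V \is a mxOver (@laurent_sq k) <-> map_mx (@laurent_twist k) V = V.
  split=> [/mxOverP Vsq | Vtw].
    by apply/matrixP => i j; rewrite mxE; apply/eqP; rewrite -laurent_sqE.
  by apply/mxOverP => i j; rewrite laurent_sqE // -{2}Vtw mxE.
split=> [[U [V [UU [UV /sqP Vtw _] def_h]]] | [U [V [UU UV Vtw def_h]]]].
  by exists U, V.
exists U, V; split=> //; split=> //; apply/sqP => //.
by rewrite map_invmx Vtw.
Qed.

Theorem theorem2p1 (k : finFieldType) (hk : 2%N \notin [pchar k])
    (m : nat) (hm : (0 < m)%N)
    (g : 'M[laurent k]_m) (hg : g \in unitmx) :
  exists s : seq block,
    (exists e : blocks_size s = m,
       in_double_coset g (castmx (e, e) (block_diag k s))) /\
    (forall (s' : seq block) (e' : blocks_size s' = m),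
       in_double_coset g (castmx (e', e') (block_diag k s')) ->
       perm_eq s s').
Proof.
have two0 : 2 != 0 :> k by move: hk; rewrite inE.
have dvr := laurent_twisted_dvr two0.
have [s [c [sc gc]]] := cocycle_split_form dvr (coboundary_cocycle dvr hg).
have [e [Us cs]] := split_form_coboundary dvr sc.
exists s; split=> [|s' e' gs'].
  exists e; apply/(in_double_cosetP _ _ two0)/(double_cosetP _ _ hg Us).
  exact: cohomologous_trans gc (cohomologous_sym cs).
(* The competing list gets its own standard cocycle. Its size n is identified with m, and proofs of
   equality of sizes are interchangeable. *)
have [n [c' sc']] := split_form_exists (@laurent_z k) s'.
have [e'' uc] := split_form_coboundary dvr sc'.
have mn : m = n by rewrite -e' e''.
case: n / mn c' sc' e'' uc => c' sc' e''; rewrite (eq_irrelevance e'' e') => -[Us' cs'].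
apply: (split_form_unique dvr sc sc').
apply: cohomologous_trans (cohomologous_sym gc) _; apply: cohomologous_trans _ cs'.
by apply/(double_cosetP _ _ hg Us')/(in_double_cosetP _ _ two0).
Qed.
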